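(* Let $C$ be a commutative ring and let $(R,P)$ be a Baxter $C$-algebra of weight $1$. Then for every integer $n\ge 1$, $$P(1)^n=\sum_{k=1}^n k!\,S(n,k)\,P^k(1)\qquad\text{and}\qquad n!\,P^n(1)=\sum_{k=1}^n s(n,k)\,P(1)^k,$$ where $s(n,k)$ and $S(n,k)$ are the Stirling numbers of the first and second kind.
   Context: Rings and algebras are associative with identity $1$. A Baxter $C$-algebra of weight $\lambda\in C$ is a pair $(R,P)$ where $R$ is a $C$-algebra and $P:R\to R$ is a $C$-linear map with $P(x)P(y)=P(xP(y))+P(P(x)y)+\lambda P(xy)$ for all $x,y\in R$. $P^k$ denotes the $k$-fold composition of $P$, so $P^k(1)$ is $P$ applied $k$ times to $1$, while $P(1)^k$ is the $k$-th power of $P(1)$ in $R$. With $(t)_n=t(t-1)\cdots(t-n+1)$ and $(t)_0=1$, the (signed) Stirling numbers of the first kind $s(n,k)$ and the Stirling numbers of the second kind $S(n,k)$ are defined by $(t)_n=\sum_{k=0}^n s(n,k)t^k$ and $t^n=\sum_{k=0}^n S(n,k)(t)_k$ in $\mathbb{Q}[t]$; they are integers. *)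

(* Defs.v *)
From HB Require Import structures.
From mathcomp Require Import all_boot all_order all_algebra.
Set Implicit Arguments.
Unset Strict Implicit.
Unset Printing Implicit Defensive.
Import Order.TTheory GRing.Theory Num.Theory.
Local Open Scope ring_scope.

(* Associative unital algebras over a commutative ring C.  MathComp's algType
   forces 1 != 0 in the algebra; this variant also allows the zero ring.  Its
   scaling is a new operation because Hierarchy Builder rejects a join of
   GRing.Lmodule and GRing.PzRing declared after GRing.LSemiAlgebra. *)
HB.mixin Record isPzAlgebra (C : comPzRingType) A of GRing.PzRing A := {
  pzscale : C -> A -> A;
  pzscalerA : forall (a b : C) (x : A), pzscale a (pzscale b x) = pzscale (a * b) x;
  pzscale1r : forall x : A, pzscale 1 x = x;
  pzscalerDr : forall (a : C) (x y : A),
    pzscale a (x + y) = pzscale a x + pzscale a y;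
  pzscalerDl : forall (a b : C) (x : A),
    pzscale (a + b) x = pzscale a x + pzscale b x;
  pzscalerAl : forall (a : C) (x y : A), pzscale a (x * y) = pzscale a x * y;
  pzscalerAr : forall (a : C) (x y : A), pzscale a (x * y) = x * pzscale a y
}.

#[short(type="pzAlgType")]
HB.structure Definition PzAlgebra (C : comPzRingType) :=
  {A of GRing.PzRing A & isPzAlgebra C A}.

Record Baxter (C : comPzRingType) (R : pzAlgType C) (lam : C) (P : R -> R) :
    Prop := {
  BaxterD : forall x y : R, P (x + y) = P x + P y;
  BaxterZ : forall (a : C) (x : R), P (pzscale a x) = pzscale a (P x);
  BaxterM : forall x y : R,
    P x * P y = P (x * P y) + P (P x * y) + pzscale lam (P (x * y))
}.

(* (t)_n = t (t - 1) ... (t - n + 1), with t = 'X *)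
Definition falling (n : nat) : {poly rat} := \prod_(i < n) ('X - i%:R%:P).

Lemma fallingS n : falling n.+1 = falling n * ('X - n%:R%:P).
Proof. by rewrite /falling big_ord_recr. Qed.

Lemma size_falling n : size (falling n) = n.+1.
Proof. by rewrite /falling -big_enum size_prod_XsubC size_enum_ord. Qed.

Lemma monic_falling n : falling n \is monic.
Proof. exact: monic_prod_XsubC. Qed.

Lemma triangular_step (b : nat -> {poly rat}) (c : nat -> int) (q : {poly rat})
    (n : nat) (f : nat -> int) :
  (forall k, b k * q = b k.+1 + (c k)%:~R *: b k) ->
  (\sum_(k < n.+1) (f k)%:~R *: b k) * q =
  \sum_(k < n.+2) ((if nat_of_ord k is j.+1 then f j else 0) +
                   (if (k <= n)%N then c k * f k else 0))%:~R *: b k.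
Proof.
move=> bq; rewrite mulr_suml.
under eq_bigr => k _ do rewrite -scalerAl bq scalerDr scalerA -intrM mulrC.
under [RHS]eq_bigr => k _ do rewrite intrD scalerDl.
rewrite !big_split /=; congr (_ + _).
  by rewrite [RHS]big_ord_recl /= scale0r add0r.
rewrite [RHS]big_ord_recr /= ltnn scale0r addr0.
by apply: eq_bigr => k _; rewrite -ltnS ltn_ord.
Qed.

Lemma stirling1_subproof (n : nat) :
  {f : nat -> int | falling n = \sum_(k < n.+1) (f k)%:~R *: 'X^k}.
Proof.
elim: n => [|n [f IHf]].
  exists (fun=> 1); rewrite big_ord1 /falling big_ord0.
  by rewrite expr0 scale1r.
exists (fun k => (if k is j.+1 then f j else 0) +
                 (if (k <= n)%N then - n%:Z * f k else 0)).
rewrite fallingS IHf.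
apply: (triangular_step (b := fun k => 'X^k) (c := fun=> - n%:Z)) => k.
by rewrite mulrBr -exprSr mulrNz scaleNr mulrC mul_polyC.
Qed.

Lemma stirling2_subproof (n : nat) :
  {f : nat -> int | 'X^n = \sum_(k < n.+1) (f k)%:~R *: falling k}.
Proof.
elim: n => [|n [f IHf]].
  exists (fun=> 1); rewrite big_ord1 /falling big_ord0.
  by rewrite expr0 scale1r.
exists (fun k => (if k is j.+1 then f j else 0) +
                 (if (k <= n)%N then k%:Z * f k else 0)).
rewrite exprSr IHf; apply: (triangular_step (c := fun k => k%:Z)) => k.
by rewrite fallingS mulrBr [_ * k%:R%:P]mulrC mul_polyC subrK.
Qed.

(* Signed Stirling numbers of the first kind s(n, k), and Stirling numbers of
   the second kind S(n, k).  The witnesses are opaque: stirling1P, stirling2P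
   and the uniqueness lemmas below characterize them. *)
Definition stirling1 (n k : nat) : int :=
  if (k <= n)%N then sval (stirling1_subproof n) k else 0.

Definition stirling2 (n k : nat) : int :=
  if (k <= n)%N then sval (stirling2_subproof n) k else 0.

Lemma stirling1P (n : nat) :
  falling n = \sum_(k < n.+1) (stirling1 n k)%:~R *: 'X^k.
Proof.
rewrite {1}(svalP (stirling1_subproof n)); apply: eq_bigr => k _.
by rewrite /stirling1 -ltnS ltn_ord.
Qed.

Lemma stirling2P (n : nat) :
  'X^n = \sum_(k < n.+1) (stirling2 n k)%:~R *: falling k.
Proof.
rewrite {1}(svalP (stirling2_subproof n)); apply: eq_bigr => k _.
by rewrite /stirling2 -ltnS ltn_ord.
Qed.

Lemma triangular_free (b : nat -> {poly rat}) (n : nat) (f g : nat -> int) :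
  (forall k, b k \is monic) -> (forall k, size (b k) = k.+1) ->
  \sum_(k < n) (f k)%:~R *: b k = \sum_(k < n) (g k)%:~R *: b k ->
  forall k, (k < n)%N -> f k = g k.
Proof.
move=> mon_b sz_b; elim: n => // n IHn eq_fg.
have coef_sum (h : nat -> int) :
    (\sum_(k < n.+1) (h k)%:~R *: b k)`_n = (h n)%:~R.
  rewrite big_ord_recr /= coefD coef_sum big1 ?add0r => [|i _].
    by have := monicP (mon_b n); rewrite /lead_coef sz_b /= coefZ => ->; rewrite mulr1.
  by rewrite coefZ nth_default ?mulr0 // sz_b.
have eq_n : f n = g n.
  by apply: (@intr_inj rat); rewrite -!coef_sum eq_fg.
move: eq_fg; rewrite !big_ord_recr /= eq_n => /addIr /IHn eq_lt k.
by rewrite ltnS leq_eqVlt => /predU1P[-> // | /eq_lt].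
Qed.

Lemma stirling1_uniq (n : nat) (f : nat -> int) :
  falling n = \sum_(k < n.+1) (f k)%:~R *: 'X^k ->
  forall k, (k <= n)%N -> f k = stirling1 n k.
Proof.
rewrite [LHS]stirling1P => /esym eq_f k k_le_n.
apply: (triangular_free (b := fun k => 'X^k) _ _ eq_f) => // i.
- exact: monicXn.
- exact: size_polyXn.
Qed.

Lemma stirling2_uniq (n : nat) (f : nat -> int) :
  'X^n = \sum_(k < n.+1) (f k)%:~R *: falling k ->
  forall k, (k <= n)%N -> f k = stirling2 n k.
Proof.
rewrite [LHS]stirling2P => /esym eq_f k k_le_n.
apply: (triangular_free _ _ eq_f) => // i.
- exact: monic_falling.
- exact: size_falling.
Qed.

(* Main.v *)
(* The elements b_k = k! P^k(1) satisfy P(1) b_k = b_(k+1) + k b_k, by applying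
   the Baxter identity to the product P(1) P(P^(k-1)(1)).  This is the relation
   t (t)_k = (t)_(k+1) + k (t)_k between falling factorials, so b_k plays the
   role of (t)_k at t = P(1), and both formulas are the two changes of basis
   between the powers t^k and the (t)_k. *)
Require Import Defs.
From mathcomp Require Import all_boot all_order all_algebra.
Set Implicit Arguments.
Unset Strict Implicit.
Unset Printing Implicit Defensive.
Import GRing.Theory.
Local Open Scope ring_scope.

Lemma stirling1_gt (n k : nat) : (n < k)%N -> stirling1 n k = 0.
Proof. by rewrite /stirling1 ltnNge => /negbTE->. Qed.

Lemma stirling2_gt (n k : nat) : (n < k)%N -> stirling2 n k = 0.
Proof. by rewrite /stirling2 ltnNge => /negbTE->. Qed.

(** Multiplying the expansion of [falling n] by [t - n] gives an expansion of [falling n.+1] in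
    powers of [t]; uniqueness of coefficients identifies the two sides. *)
Lemma stirling1S (n k : nat) :
  stirling1 n.+1 k =
  (if k is j.+1 then stirling1 n j else 0) + - n%:Z * stirling1 n k.
Proof.
have [lt_nk|le_kn] := ltnP n.+1 k.
  case: k lt_nk => // k lt_nk.
  by rewrite !stirling1_gt ?mulr0 //; apply: ltnW.
rewrite -(@stirling1_uniq n.+1 (fun k => (if k is j.+1 then stirling1 n j else 0)
  + (if (k <= n)%N then - n%:Z * stirling1 n k else 0))) //; last first.
  rewrite fallingS stirling1P.
  apply: (@triangular_step (fun k => 'X^k) (fun=> - n%:Z)) => j.
  by rewrite mulrBr -exprSr mulrNz scaleNr mulrC mul_polyC.
(* The guard fails only at [k = n.+1], where [stirling1 n k] is zero anyway. *)
by case: leqP => // /stirling1_gt ->; rewrite mulr0.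
Qed.

(** Same argument for [t ^ n * t], expanded by [t (t)_k = (t)_(k+1) + k (t)_k]. *)
Lemma stirling2S (n k : nat) :
  stirling2 n.+1 k =
  (if k is j.+1 then stirling2 n j else 0) + k%:Z * stirling2 n k.
Proof.
have [lt_nk|le_kn] := ltnP n.+1 k.
  case: k lt_nk => // k lt_nk.
  by rewrite !stirling2_gt ?mulr0 //; apply: ltnW.
rewrite -(@stirling2_uniq n.+1 (fun k => (if k is j.+1 then stirling2 n j else 0)
  + (if (k <= n)%N then k%:Z * stirling2 n k else 0))) //; last first.
  rewrite exprSr stirling2P.
  apply: (@triangular_step _ (fun k => k%:Z)) => j.
  by rewrite fallingS mulrBr [_ * j%:R%:P]mulrC mul_polyC subrK.
by case: leqP => // /stirling2_gt ->; rewrite mulr0.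
Qed.

Lemma stirling1_00 : stirling1 0 0 = 1.
Proof.
rewrite -(@stirling1_uniq 0 (fun=> 1)) // big_ord1 /falling big_ord0.
by rewrite expr0 scale1r.
Qed.

Lemma stirling2_00 : stirling2 0 0 = 1.
Proof.
rewrite -(@stirling2_uniq 0 (fun=> 1)) // big_ord1 /falling big_ord0.
by rewrite expr0 scale1r.
Qed.

Lemma stirling1_S0 (n : nat) : stirling1 n.+1 0 = 0.
Proof. by elim: n => [|n IHn]; rewrite stirling1S add0r ?IHn ?mulr0 ?mul0r. Qed.

Lemma stirling2_S0 (n : nat) : stirling2 n.+1 0 = 0.
Proof. by rewrite stirling2S mul0r. Qed.

(** Counterpart of [triangular_step] in an arbitrary ring, with integer multiples in place of
    rational scalars; the vanishing of [f n.+1] replaces the guard [k <= n]. *)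
Lemma mulr_sum_triangular (R : pzRingType) (a : R) (b : nat -> R)
    (c f : nat -> int) (n : nat) :
  (forall k, a * b k = b k.+1 + b k *~ c k) -> f n.+1 = 0 ->
  a * (\sum_(k < n.+1) b k *~ f k) =
  \sum_(k < n.+2) b k *~ ((if nat_of_ord k is j.+1 then f j else 0) + c k * f k).
Proof.
move=> ab fn0; rewrite mulr_sumr.
under eq_bigr => k _ do rewrite mulrzAr ab mulrzDl -mulrzA.
under [RHS]eq_bigr => k _ do rewrite mulrzDr.
rewrite !big_split /=; congr (_ + _).
  by rewrite [RHS]big_ord_recl /= mulr0z add0r.
by rewrite [RHS]big_ord_recr /= fn0 mulr0 mulr0z addr0.
Qed.

Section Falling.
Variables (R : pzRingType) (a : R) (b : nat -> R).
Hypotheses (b0 : b 0%N = 1) (ab : forall k, a * b k = b k.+1 + b k *+ k).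

(** [R] may have torsion, so the identity in [rat] polynomials cannot simply be evaluated at [a];
    the integer recurrence for [stirling2] is replayed in [R]. *)
Lemma expr_stirling2 (n : nat) : a ^+ n = \sum_(k < n.+1) b k *~ stirling2 n k.
Proof.
elim: n => [|n IHn]; first by rewrite big_ord1 stirling2_00 b0.
rewrite exprS IHn (@mulr_sum_triangular _ _ _ (fun k => k%:Z)) //.
  by apply: eq_bigr => k _; rewrite stirling2S.
exact: stirling2_gt.
Qed.

Lemma falling_stirling1 (n : nat) :
  b n = \sum_(k < n.+1) a ^+ k *~ stirling1 n k.
Proof.
elim: n => [|n IHn]; first by rewrite big_ord1 stirling1_00 b0.
(* This is the recursion of the falling factorials at [t = a]. *)
have -> : b n.+1 = (a - n%:R) * b n by rewrite mulrBl ab mulr_natl addrK.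
rewrite IHn (@mulr_sum_triangular _ _ _ (fun=> - n%:Z)).
- by apply: eq_bigr => k _; rewrite stirling1S.
- by move=> k; rewrite mulrBl -exprS mulr_natl mulrNz.
- exact: stirling1_gt.
Qed.

End Falling.

Lemma Baxter1_mul_iter (C : comPzRingType) (R : pzAlgType C) (P : R -> R) :
  Baxter 1 P -> forall k : nat,
  P 1 * iter k P 1 = iter k.+1 P 1 *+ k.+1 + iter k P 1 *+ k.
Proof.
move=> [PD _ PM].
have P0 : P 0 = 0 by apply: (addrI (P 0)); rewrite -PD !addr0.
have PMn x m : P (x *+ m) = P x *+ m.
  by elim: m => [|m IHm]; rewrite ?mulr0n // !mulrS PD IHm.
elim=> [|k IHk]; first by rewrite mulr1 addr0.
(* With [x = 1] and [y = P^k(1)], the Baxter identity yields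
   [P^(k+2)(1) + P(P(1) P^k(1)) + P^(k+1)(1)]; the induction hypothesis expands the middle term, and
   each multiplicity grows by one. *)
rewrite [iter k.+1 P 1]iterS PM IHk PD !PMn pzscale1r !mul1r.
by rewrite -!iterS addrA -mulrS -addrA -mulrSr.
Qed.

Theorem theorem1p1 (C : comPzRingType) (R : pzAlgType C) (P : R -> R)
    (hP : Baxter 1 P) (n : nat) (hn : (1 <= n)%N) :
  P 1 ^+ n =
    \sum_(1 <= k < n.+1) k`!%:R * (stirling2 n k)%:~R * iter k P 1
  /\
  n`!%:R * iter n P 1 =
    \sum_(1 <= k < n.+1) (stirling1 n k)%:~R * P 1 ^+ k.
Proof.
pose b k := iter k P 1 *+ k`!.
have b0 : b 0%N = 1 by [].
have ab k : P 1 * b k = b k.+1 + b k *+ k.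
  rewrite /b mulrnAr (Baxter1_mul_iter hP) mulrnDl -!mulrnA factS.
  by rewrite [(k * _)%N]mulnC.
(* As the exponent is positive, the coefficient at [k = 0] vanishes in both expansions, so the sums
   may start at 1. *)
case: n hn => // n _; split.
  rewrite (expr_stirling2 b0 ab) -(big_mkord xpredT (fun k => b k *~ _ k)).
  rewrite big_ltn // stirling2_S0 mulr0z add0r; apply: eq_bigr => k _.
  by rewrite -mulrA mulrzl mulr_natl /b !pmulrn mulrzAC.
rewrite mulr_natl -/(b n.+1) (falling_stirling1 b0 ab).
rewrite -(big_mkord xpredT (fun k => P 1 ^+ k *~ _ k)).
rewrite big_ltn // stirling1_S0 mulr0z add0r; apply: eq_bigr => k _.
by rewrite mulrzl.
Qed.
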